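(* Let $S$ be a $\Gamma$-semiring which has a left unity and a right unity, and let $L$ be its left operator semiring. For a fuzzy subset $\sigma$ of $S$ let $\sigma^{+'}$ be the fuzzy subset of $L$ given by $\sigma^{+'}(\sum_i[x_i,\alpha_i])=\inf_{a\in S}\sigma(\sum_i x_i\alpha_i a)$, and for a fuzzy subset $\mu$ of $L$ let $\mu^{+}$ be the fuzzy subset of $S$ given by $\mu^{+}(a)=\inf_{\alpha\in\Gamma}\mu([a,\alpha])$. Then: (1) if $\sigma$ is a fuzzy $k$-ideal of $S$, then $\sigma^{+'}$ is a fuzzy $k$-ideal of $L$; (2) if $\mu$ is a fuzzy $k$-ideal of $L$, then $\mu^{+}$ is a fuzzy $k$-ideal of $S$.
   Context: $\Gamma$-semiring: $S$ and $\Gamma$ are (nonempty) additive commutative semigroups with a map $S\times\Gamma\times S\to S$, $(a,\alpha,b)\mapsto a\alpha b$, such that $a\alpha(b+c)=a\alpha b+a\alpha c$, $(a+b)\alpha c=a\alpha c+b\alpha c$, $a(\alpha+\beta)c=a\alpha c+a\beta c$, $a\alpha(b\beta c)=(a\alpha b)\beta c$ for all $a,b,c\in S$, $\alpha,\beta\in\Gamma$. No zero elements are assumed. Left operator semiring $L$: let $F$ be the free additive commutative semigroup generated by $S\times\Gamma$ (finite nonempty formal sums). The relation $\sum_i(x_i,\alpha_i)\,\rho\,\sum_j(y_j,\beta_j)$ iff $\sum_i x_i\alpha_i a=\sum_j y_j\beta_j a$ for all $a\in S$ is a congruence on $F$. The class of $\sum_i(x_i,\alpha_i)$ is written $\sum_i[x_i,\alpha_i]$.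 $L=F/\rho$ with the induced addition and the multiplication $(\sum_i[x_i,\alpha_i])(\sum_j[y_j,\beta_j])=\sum_{i,j}[x_i\alpha_i y_j,\beta_j]$ is a semiring. Unities: a left unity of $S$ is a finite sum $\sum_i[e_i,\delta_i]\in L$ with $\sum_i e_i\delta_i a=a$ for all $a\in S$. A right unity of $S$ is given by finitely many $\gamma_j\in\Gamma$, $f_j\in S$ with $\sum_j a\gamma_j f_j=a$ for all $a\in S$. A fuzzy subset of a set $X$ is a function $X\to[0,1]$. A fuzzy subset $\mu$ of $S$ is a fuzzy ideal of $S$ if $\mu(a+b)\ge\min(\mu(a),\mu(b))$, $\mu(a\alpha b)\ge\mu(a)$ and $\mu(a\alpha b)\ge\mu(b)$ for all $a,b\in S$, $\alpha\in\Gamma$. A fuzzy subset $\mu$ of $L$ is a fuzzy ideal of $L$ if $\mu(p+q)\ge\min(\mu(p),\mu(q))$, $\mu(pq)\ge\mu(p)$ and $\mu(pq)\ge\mu(q)$ for all $p,q\in L$. A fuzzy ideal $\mu$ (of $S$ or of $L$) is a fuzzy $k$-ideal if $\mu(x)\ge\min(\mu(x+y),\mu(y))$ for all $x,y$ (in $S$, respectively in $L$). *)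

(* Defs.v *)
From HB Require Import structures.
From mathcomp Require Import all_boot all_order all_algebra generic_quotient.
From mathcomp Require Import finmap multiset.
From mathcomp Require Import all_classical all_reals.

Set Implicit Arguments.
Unset Strict Implicit.
Unset Printing Implicit Defensive.

Import Order.TTheory GRing.Theory Num.Theory.

Local Open Scope fset_scope.
Local Open Scope mset_scope.
Local Open Scope quotient_scope.
Local Open Scope ring_scope.

(* The free commutative semigroup on T: nonempty finite multisets, which
   represent the nonempty finite formal sums of elements of T. *)
Record freeSG (T : choiceType) := FreeSG {
  fsg_val :> {mset T};
  _ : fsg_val != mset0
}.

HB.instance Definition _ (T : choiceType) := [isSub for @fsg_val T].
HB.instance Definition _ (T : choiceType) := [Choice of freeSG T by <:].

Section FreeSGAdd.
Variable T : choiceType.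
Implicit Types u v w : freeSG T.

Lemma fsg_gen_neq0 (t : T) : [mset t]%mset != mset0.
Proof. by apply/eqP => /msetP/(_ t); rewrite msetnxx mset0E. Qed.

Definition fsg_gen (t : T) : freeSG T := FreeSG (fsg_gen_neq0 t).

Lemma fsg_add_neq0 u v : (fsg_val u `+` fsg_val v)%mset != mset0.
Proof.
case: u => u /= nu; apply/eqP => /msetP uv0; case/eqP: nu; apply/msetP => t.
have /eqP := uv0 t; rewrite msetE2 mset0E addn_eq0 => /andP[/eqP ut0 _].
by rewrite ut0.
Qed.

Definition fsg_add u v : freeSG T := FreeSG (fsg_add_neq0 u v).

Lemma fsg_addC : commutative fsg_add.
Proof. by move=> u v; apply: val_inj; rewrite /= msetDC. Qed.

Lemma fsg_addA : associative fsg_add.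
Proof. by move=> u v w; apply: val_inj; rewrite /= msetDA. Qed.

HB.instance Definition _ :=
  Algebra.isAddSemigroup.Build (freeSG T) fsg_addC fsg_addA.

Lemma fsg_seq_neq0 w : (w : seq T) != [::].
Proof.
case: w => w /= nw; apply/eqP => w0; case/eqP: nw.
by rewrite -[w]seq_mset_id w0; apply/msetP => t; rewrite mset_seqE mset0E.
Qed.

Lemma fsg_ind (P : freeSG T -> Prop) :
  (forall t, P (fsg_gen t)) -> (forall t w, P w -> P (fsg_gen t + w)) ->
  forall w, P w.
Proof.
move=> P1 PD [w nw]; move: nw; rewrite -[w]seq_mset_id.
elim: (w : seq T) => [|t s IH] nw.
  by case/eqP: (nw); apply/msetP => t; rewrite mset_seqE mset0E.
have [s0|ns] := eqVneq (seq_mset s) mset0.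
  suff -> : FreeSG nw = fsg_gen t by [].
  by apply: val_inj; rewrite /= mset_cons s0 msetD0.
suff -> : FreeSG nw = fsg_gen t + FreeSG ns by apply/PD/IH.
by apply: val_inj; rewrite /= mset_cons.
Qed.

End FreeSGAdd.

Definition nonempty_foldl (T : eqType) (V : addSemigroupType) (f : T -> V)
    (s : seq T) : s != [::] -> V :=
  match s with
  | [::] => fun nil_neq_nil => match notF nil_neq_nil with end
  | t :: s' => fun _ => foldl (fun x u => x + f u) (f t) s'
  end.

(* The sum of the f t for t in the formal sum w: the homomorphism from the
   free semigroup that extends f. V need not have a zero. *)
Definition fsg_sum (T : choiceType) (V : addSemigroupType) (f : T -> V)
    (w : freeSG T) : V :=
  nonempty_foldl f (fsg_seq_neq0 w).

Section FreeSGSum.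
Variables (T : choiceType) (V : addSemigroupType).
Implicit Types (f g h : T -> V) (u v w : freeSG T).

Let osum f (s : seq T) : option V :=
  \big[oAC (@Algebra.addrA V) (@Algebra.addrC V) / None]_(t <- s) Some (f t).

Let nonempty_foldlE f s (ns : s != [::]) :
  Some (nonempty_foldl f ns) = osum f s.
Proof.
case: s ns => // t s ns; rewrite /osum big_cons /= {ns}.
elim/last_ind: s => [|s u IH]; first by rewrite big_nil.
rewrite foldl_rcons -(oACE (@Algebra.addrA V) (@Algebra.addrC V)) IH.
by rewrite -cats1 big_cat big_seq1 /= [RHS]Monoid.mulmA.
Qed.

Lemma fsg_sum_gen f t : fsg_sum f (fsg_gen t) = f t.
Proof.
apply: Some_inj; rewrite /fsg_sum nonempty_foldlE /=.
by rewrite /fsg_gen /= enum_msetn /osum big_seq1.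
Qed.

Lemma fsg_sumD f u v : fsg_sum f (u + v) = fsg_sum f u + fsg_sum f v.
Proof.
apply: Some_inj; rewrite -(oACE (@Algebra.addrA V) (@Algebra.addrC V)) !nonempty_foldlE.
rewrite /osum -big_cat; apply: perm_big.
by apply/allP => t _; rewrite /= count_cat !count_mem_mset msetE2.
Qed.

Lemma fsg_sum_unique f (h : freeSG T -> V) :
    (forall t, h (fsg_gen t) = f t) -> {morph h : u v / u + v} ->
  h =1 fsg_sum f.
Proof.
move=> h1 hD; elim/fsg_ind => [t|t w IH]; first by rewrite h1 fsg_sum_gen.
by rewrite hD h1 fsg_sumD fsg_sum_gen IH.
Qed.

End FreeSGSum.

HB.mixin Record isGammaSemiring (G : addSemigroupType) (S : Type)
    of Algebra.AddSemigroup S := {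
  gmul : S -> G -> S -> S;
  gsr_inhabited : inhabited S;
  gsr_scalar_inhabited : inhabited G;
  gmulDr : forall a x b c, gmul a x (b + c) = gmul a x b + gmul a x c;
  gmulDl : forall a b x c, gmul (a + b) x c = gmul a x c + gmul b x c;
  gmulDm : forall a x y c, gmul a (x + y) c = gmul a x c + gmul a y c;
  gmulA : forall a x b y c, gmul a x (gmul b y c) = gmul (gmul a x b) y c
}.

#[short(type="gammaSemiringType")]
HB.structure Definition GammaSemiring (G : addSemigroupType) :=
  {S of isGammaSemiring G S & Algebra.AddSemigroup S}.

Arguments gmul {G s}.

Section LeftOperatorSemiring.
Variables (G : addSemigroupType) (S : gammaSemiringType G).
Local Notation F := (freeSG (S * G)%type).
Implicit Types (u v w : F) (a b c : S) (x y : G).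

Definition formal_act w a : S := fsg_sum (fun p => gmul p.1 p.2 a) w.

Definition formal_mul u v : F :=
  fsg_sum (fun p => fsg_sum (fun q => fsg_gen (gmul p.1 p.2 q.1, q.2)) v) u.

Lemma formal_act_gen a x b : formal_act (fsg_gen (a, x)) b = gmul a x b.
Proof. exact: fsg_sum_gen. Qed.

Lemma formal_actDl u v a : formal_act (u + v) a = formal_act u a + formal_act v a.
Proof. exact: fsg_sumD. Qed.

Lemma formal_actDr w a b : formal_act w (a + b) = formal_act w a + formal_act w b.
Proof.
elim/fsg_ind: w => [[c x]|[c x] w IH]; first by rewrite !formal_act_gen gmulDr.
by rewrite !formal_actDl !formal_act_gen IH gmulDr Algebra.addrACA.
Qed.

Lemma gmul_formal_act a x v b :
  formal_act (fsg_sum (fun q => fsg_gen (gmul a x q.1, q.2)) v) b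
  = gmul a x (formal_act v b).
Proof.
elim/fsg_ind: v => [[c y]|[c y] v IH].
  by rewrite fsg_sum_gen /= !formal_act_gen gmulA.
by rewrite fsg_sumD fsg_sum_gen /= !formal_actDl IH !formal_act_gen gmulDr gmulA.
Qed.

Lemma formal_actM u v a : formal_act (formal_mul u v) a = formal_act u (formal_act v a).
Proof.
elim/fsg_ind: u => [[c x]|[c x] u IH].
  by rewrite /formal_mul fsg_sum_gen /= gmul_formal_act formal_act_gen.
rewrite /formal_mul fsg_sumD fsg_sum_gen /= !formal_actDl -/(formal_mul u v).
by rewrite IH gmul_formal_act formal_act_gen.
Qed.

Definition rho u v : bool := `[< forall a, formal_act u a = formal_act v a >].

Lemma rho_refl : reflexive rho.
Proof. by move=> u; apply/asboolP. Qed.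

Lemma rho_sym : symmetric rho.
Proof. by move=> u v; apply/asboolP/asboolP => uv a; rewrite uv. Qed.

Lemma rho_trans : transitive rho.
Proof.
by move=> v u w /asboolP uv /asboolP vw; apply/asboolP => a; rewrite uv.
Qed.

Canonical rho_equiv := EquivRel rho rho_refl rho_sym rho_trans.

Definition lopsr := {eq_quot rho}.

HB.instance Definition _ := Choice.on lopsr.
HB.instance Definition _ := EqQuotient.on lopsr.

Implicit Types p q r : lopsr.

(* The class [a, x]. *)
Definition lop_gen a x : lopsr := \pi_lopsr (fsg_gen (a, x)).

(* sum_i x_i alpha_i a, for a class sum_i [x_i, alpha_i]; independent of the
   representative by lact_pi below. *)
Definition lact p a : S := formal_act (repr p) a.

Lemma lact_pi w a : lact (\pi_lopsr w) a = formal_act w a.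
Proof.
have /eqP : repr (\pi_lopsr w) = w %[mod lopsr] by rewrite reprK.
by rewrite piE => /asboolP; apply.
Qed.

Lemma lact_gen a x b : lact (lop_gen a x) b = gmul a x b.
Proof. by rewrite lact_pi formal_act_gen. Qed.

Lemma lact_inj p q : lact p =1 lact q -> p = q.
Proof.
by move=> pq; rewrite -[p]reprK -[q]reprK; apply/eqP; rewrite piE; apply/asboolP.
Qed.

(* By pi_add and pi_mul below, these are the operations induced on classes. *)
Definition lop_add p q : lopsr := \pi_lopsr (repr p + repr q).
Definition lmul p q : lopsr := \pi_lopsr (formal_mul (repr p) (repr q)).

Let lact_add p q a : lact (lop_add p q) a = lact p a + lact q a.
Proof. by rewrite lact_pi formal_actDl. Qed.

Let lop_addC : commutative lop_add.
Proof. by move=> p q; apply: lact_inj => a; rewrite !lact_add Algebra.addrC. Qed.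

Let lop_addA : associative lop_add.
Proof. by move=> p q r; apply: lact_inj => a; rewrite !lact_add Algebra.addrA. Qed.

HB.instance Definition _ :=
  Algebra.isAddSemigroup.Build lopsr lop_addC lop_addA.

Lemma lactDl p q a : lact (p + q) a = lact p a + lact q a.
Proof. exact: lact_add. Qed.

Lemma lactDr p a b : lact p (a + b) = lact p a + lact p b.
Proof. exact: formal_actDr. Qed.

Lemma lactM p q a : lact (lmul p q) a = lact p (lact q a).
Proof. by rewrite lact_pi formal_actM. Qed.

Lemma pi_add u v : \pi_lopsr (u + v) = \pi_lopsr u + \pi_lopsr v.
Proof. by apply: lact_inj => a; rewrite lactDl !lact_pi formal_actDl. Qed.

Lemma pi_mul u v : \pi_lopsr (formal_mul u v) = lmul (\pi_lopsr u) (\pi_lopsr v).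
Proof. by apply: lact_inj => a; rewrite lactM !lact_pi formal_actM. Qed.

Lemma lmulA : associative lmul.
Proof. by move=> p q r; apply: lact_inj => a; rewrite !lactM. Qed.

Lemma lmulDl : left_distributive lmul +%R.
Proof. by move=> p q r; apply: lact_inj => a; rewrite !(lactM, lactDl). Qed.

Lemma lmulDr : right_distributive lmul +%R.
Proof.
by move=> p q r; apply: lact_inj => a; rewrite !(lactM, lactDl) lactDr.
Qed.

Definition left_unity (e : lopsr) := forall a, lact e a = a.

(* The formal sum w stands for the finitely many pairs (gamma_j, f_j). *)
Definition right_unity (w : freeSG (G * S)%type) :=
  forall a, fsg_sum (fun g : G * S => gmul a g.1 g.2) w = a.

End LeftOperatorSemiring.

Section Fuzzy.
Variable R : realType.

Definition fuzzy_subset (X : Type) (mu : X -> R) := forall x, 0 <= mu x <= 1.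

Variables (G : addSemigroupType) (S : gammaSemiringType G).

Record fuzzy_ideal (mu : S -> R) : Prop := {
  fuzzy_ideal_subset : fuzzy_subset mu;
  fuzzy_idealD : forall a b, Num.min (mu a) (mu b) <= mu (a + b);
  fuzzy_idealMl : forall a (x : G) b, mu a <= mu (gmul a x b);
  fuzzy_idealMr : forall a (x : G) b, mu b <= mu (gmul a x b)
}.

Record fuzzy_lideal (mu : lopsr S -> R) : Prop := {
  fuzzy_lideal_subset : fuzzy_subset mu;
  fuzzy_lidealD : forall p q, Num.min (mu p) (mu q) <= mu (p + q);
  fuzzy_lidealMl : forall p q, mu p <= mu (lmul p q);
  fuzzy_lidealMr : forall p q, mu q <= mu (lmul p q)
}.

Definition fuzzy_k (V : addSemigroupType) (mu : V -> R) :=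
  forall x y, Num.min (mu (x + y)) (mu y) <= mu x.

Definition fuzzy_kideal (mu : S -> R) := fuzzy_ideal mu /\ fuzzy_k mu.
Definition fuzzy_klideal (mu : lopsr S -> R) := fuzzy_lideal mu /\ fuzzy_k mu.

Definition fuzzy_plus' (sigma : S -> R) (p : lopsr S) : R :=
  inf [set sigma (lact p a) | a in [set: S]]%classic.

Definition fuzzy_plus (mu : lopsr S -> R) (a : S) : R :=
  inf [set mu (lop_gen a x) | x in [set: G]]%classic.

End Fuzzy.

(* Main.v *)
(** Both transfers are pointwise: evaluation [p |-> p a] at a fixed [a] and the
    embedding [a |-> [a, x]] at a fixed [x] are additive, and both
    respect products: [(p q) a = p (q a)] and [[a x b, y] = [a, x] [b, y]].
    Every inequality can thus be checked at each point of the set whose infimum is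
    being bounded below. *)
Require Import Defs.
From mathcomp Require Import all_boot all_order all_algebra all_reals.
From mathcomp Require Import classical_sets.

Import Order.TTheory Num.Theory.
Local Open Scope ring_scope.

Section InfImage.
Variables (R : realType) (I : Type) (f : I -> R).
Hypothesis f01 : fuzzy_subset f.

Lemma inf_image_le i : inf [set f j | j in [set: I]]%classic <= f i.
Proof.
apply: ge_inf; last by exists i.
by exists 0 => _ [j _ <-]; case/andP: (f01 j).
Qed.

(** The index type must be inhabited: [inf] of the empty set is 0 by convention, so the bound would
    fail for positive [c]. *)
Lemma le_inf_image c : inhabited I -> (forall i, c <= f i) ->
  c <= inf [set f j | j in [set: I]]%classic.
Proof.
by case=> i0 cf; apply: lb_le_inf; [exists (f i0), i0 | move=> _ [j _ <-]].
Qed.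

Lemma inf_image_itv01 : inhabited I ->
  0 <= inf [set f j | j in [set: I]]%classic <= 1.
Proof.
move=> I0; apply/andP; split.
  by apply: le_inf_image => // i; case/andP: (f01 i).
by case: I0 => i; apply: le_trans (inf_image_le i) _; case/andP: (f01 i).
Qed.

End InfImage.

Section Transfer.
Variables (R : realType) (G : addSemigroupType) (S : gammaSemiringType G).

(** Classes in [lopsr S] are determined by their action on [S], so this reduces to [gmulDl], and
    [lop_genM] likewise to [gmulA]. *)
Lemma lop_genD (a b : S) (x : G) : lop_gen (a + b) x = lop_gen a x + lop_gen b x.
Proof. by apply: lact_inj => c; rewrite lactDl !lact_gen gmulDl. Qed.

Lemma lop_genM (a b : S) (x y : G) :
  lop_gen (gmul a x b) y = lmul (lop_gen a x) (lop_gen b y).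
Proof. by apply: lact_inj => c; rewrite lactM !lact_gen gmulA. Qed.

(** Each summand [gmul c x a] of [lact p a] has value at least [sigma a] by absorption on the right
    factor, and the min-inequality carries this bound through the nonempty sum. *)
Lemma fuzzy_ideal_lact (sigma : S -> R) (p : lopsr S) (a : S) :
  fuzzy_ideal sigma -> sigma a <= sigma (lact p a).
Proof.
move=> [_ sD _ sMr]; rewrite /lact; elim/fsg_ind: (repr p) => [[c x]|[c x] w IH].
  by rewrite formal_act_gen.
rewrite formal_actDl formal_act_gen; apply: le_trans (sD _ _).
by rewrite le_min sMr.
Qed.

Lemma fuzzy_plus'_kideal (sigma : S -> R) :
  fuzzy_kideal sigma -> fuzzy_klideal (fuzzy_plus' sigma).
Proof.
move=> [sI sk]; have [s01 sD _ _] := sI.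
have S0 : inhabited S := gsr_inhabited.
have act01 p : fuzzy_subset (fun a => sigma (lact p a)) by move=> a; apply: s01.
have plus_le p a : fuzzy_plus' sigma p <= sigma (lact p a).
  exact: (inf_image_le _ _ _ (act01 p)).
have le_plus p c : (forall a, c <= sigma (lact p a)) -> c <= fuzzy_plus' sigma p.
  exact: le_inf_image.
split; first split.
- by move=> p; apply: inf_image_itv01.
- move=> p q; apply: le_plus => a; rewrite lactDl.
  by apply: le_trans (sD _ _); rewrite le_min !ge_min !plus_le orbT.
(* The value of the product at [a] is that of [p] at the point [lact q a], already in the set whose
   infimum is taken for [p]. *)
- by move=> p q; apply: le_plus => a; rewrite lactM plus_le.
- move=> p q; apply: le_plus => a; rewrite lactM.
  exact: le_trans (plus_le q a) (fuzzy_ideal_lact _ _ _ sI).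
(* The [k]-property of [sigma] is used at [lact p a] and [lact q a], whose sum is
   [lact (p + q) a]. *)
- move=> p q; apply: le_plus => a; apply: le_trans (sk _ (lact q a)).
  by rewrite -lactDl le_min !ge_min !plus_le orbT.
Qed.

Lemma fuzzy_plus_kideal (mu : lopsr S -> R) :
  fuzzy_klideal mu -> fuzzy_kideal (fuzzy_plus mu).
Proof.
move=> [[m01 mD mMl mMr] mk].
have G0 : inhabited G := @gsr_scalar_inhabited G S.
have gen01 a : fuzzy_subset (fun x => mu (lop_gen a x)) by move=> x; apply: m01.
have plus_le a x : fuzzy_plus mu a <= mu (lop_gen a x).
  exact: (inf_image_le _ _ _ (gen01 a)).
have le_plus a c : (forall x, c <= mu (lop_gen a x)) -> c <= fuzzy_plus mu a.
  exact: le_inf_image.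
split; first split.
- by move=> a; apply: inf_image_itv01.
- move=> a b; apply: le_plus => x; rewrite lop_genD.
  by apply: le_trans (mD _ _); rewrite le_min !ge_min !plus_le orbT.
(* The infimum for [a] is compared at the fixed scalar [x] of the product, whatever [y] is; for the
   right factor below, [y] itself is the point of comparison. *)
- move=> a x b; apply: le_plus => y; rewrite lop_genM.
  exact: le_trans (plus_le a x) (mMl _ _).
- move=> a x b; apply: le_plus => y; rewrite lop_genM.
  exact: le_trans (plus_le b y) (mMr _ _).
- move=> a b; apply: le_plus => x; apply: le_trans (mk _ (lop_gen b x)).
  by rewrite -lop_genD le_min !ge_min !plus_le orbT.
Qed.

End Transfer.

Theorem proposition3p7 (R : realType) (G : addSemigroupType)
    (S : gammaSemiringType G)
    (has_left_unity : exists e : lopsr S, left_unity e)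
    (has_right_unity : exists w : freeSG (G * S)%type, right_unity w) :
  (forall sigma : S -> R, fuzzy_kideal sigma -> fuzzy_klideal (fuzzy_plus' sigma))
  /\ (forall mu : lopsr S -> R, fuzzy_klideal mu -> fuzzy_kideal (fuzzy_plus mu)).
Proof. by split=> ?; [apply: fuzzy_plus'_kideal | apply: fuzzy_plus_kideal]. Qed.
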